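(* Consider a tensor-product mesh of a rectangular domain $\Omega=(a,b)\times(c,d)$, with nodes $(x_i,y_j)$, $0\le i\le n$, $0\le j\le m$, that satisfy $$a=x_0<x_1<\dots<x_n=b,\qquad c=y_0<y_1<\dots<y_m=d.$$ Let $A$ and $M$ be the stiffness and mass matrices of the $Q_1(\Omega)$ (continuous piecewise bilinear) finite-element discretization on this mesh. Then this discretization satisfies the unique continuation principle. In fact, for $\lambda\in\mathbb{R}$, any solution $u$ to $Au=\lambda Mu$ that vanishes at the nodes $\{(x_i,y_0)\}_{i=0}^n$ and $\{(x_0,y_j)\}_{j=0}^m$ must be identically zero.
   Context: The elements of the mesh are the rectangles $[x_{i-1},x_i]\times[y_{j-1},y_j]$, $1\le i\le n$, $1\le j\le m$. For each node $\boldsymbol{x}_k$ of the mesh, $\phi_k$ is the continuous function on $\overline\Omega$ whose restriction to each element is a polynomial of degree at most one in each variable separately, with $\phi_k(\boldsymbol{x}_l)=\delta_{k,l}$ for all nodes $\boldsymbol{x}_l$. The stiffness and mass matrices have entries $a_{k,l}=\int_\Omega\nabla\phi_l\cdot\nabla\phi_k\,dA$ and $m_{k,l}=\int_\Omega\phi_l\phi_k\,dA$. A vector $u$ is indexed by the nodes, and ''$u$ vanishes at a node'' means the corresponding entry is zero. Order the nodes with the interior ones (those not on $\partial\Omega$) first and the boundary ones (those on $\partial\Omega$) last, and write $$A=\begin{pmatrix} A_{II} & A_{IB} \\ A_{BI} & A_{BB} \end{pmatrix},\qquad M=\begin{pmatrix} M_{II} & M_{IB} \\ M_{BI} & M_{BB}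 \end{pmatrix}.$$ The set of inner solutions is $\mathcal{S}_{\rm in}(\lambda)=\ker(A_{II}-\lambda M_{II})\cap\ker(A_{BI}-\lambda M_{BI})$, and the discretization satisfies the unique continuation principle if $\mathcal{S}_{\rm in}(\lambda)=\{0\}$ for all $\lambda\in\mathbb{R}$. *)

(* Defs.v *)
From HB Require Import structures.
From mathcomp Require Import all_boot all_order all_algebra.
From mathcomp Require Import all_classical all_reals all_analysis.

Set Implicit Arguments.
Unset Strict Implicit.
Unset Printing Implicit Defensive.

Import Order.TTheory GRing.Theory Num.Theory.
Import numFieldNormedType.Exports.

Local Open Scope classical_set_scope.
Local Open Scope ring_scope.

(* Only the values x 0, ..., x n of the sequence x are meaningful. *)
Definition is_grid (R : realType) (a b : R) (n : nat) (x : nat -> R) : Prop :=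
  [/\ x 0%N = a, x n = b & forall i, (i < n)%N -> x i < x i.+1].

Definition open_rect (R : realType) (a b c d : R) : set (R * R) :=
  `]a, b[%classic `*` `]c, d[%classic.

(* The element with upper right corner (x i.+1, y j.+1). *)
Definition mesh_element (R : realType) (x y : nat -> R) (i j : nat) :
    set (R * R) :=
  `[x i, x i.+1]%classic `*` `[y j, y j.+1]%classic.

Definition node_pos (R : realType) (x y : nat -> R) (n m : nat)
    (ij : 'I_n.+1 * 'I_m.+1) : R * R :=
  (x ij.1, y ij.2).

Definition boundary (T : topologicalType) (S : set T) : set T :=
  closure S `\` interior S.

(* A numbering of all the nodes in which the p interior ones come first and
   the q boundary ones last; the order within each group is arbitrary. *)
Definition interior_first (R : realType) (Omega : set (R * R))
    (n m : nat) (x y : nat -> R) (p q : nat)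
    (node : 'I_(p + q) -> 'I_n.+1 * 'I_m.+1) : Prop :=
  [/\ bijective node,
      forall k : 'I_p, ~ boundary Omega (node_pos x y (node (lshift q k))) &
      forall k : 'I_q, boundary Omega (node_pos x y (node (rshift p k)))].

Definition bilinear_on (R : realType) (E : set (R * R)) (f : R * R -> R) :
    Prop :=
  exists c00 c10 c01 c11 : R, forall z, E z ->
    f z = c00 + c10 * z.1 + c01 * z.2 + c11 * (z.1 * z.2).

Definition in_Q1 (R : realType) (Omega : set (R * R)) (n m : nat)
    (x y : nat -> R) (f : R * R -> R) : Prop :=
  {within closure Omega, continuous f} /\
  forall i j, (i < n)%N -> (j < m)%N -> bilinear_on (mesh_element x y i j) f.

(* phi k is determined by this on the closure of Omega only; its values
   elsewhere do not affect the integrals over Omega below. *)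
Definition Q1_nodal_basis (R : realType) (Omega : set (R * R)) (n m : nat)
    (x y : nat -> R) (N : nat) (node : 'I_N -> 'I_n.+1 * 'I_m.+1)
    (phi : 'I_N -> R * R -> R) : Prop :=
  forall k : 'I_N, in_Q1 Omega n m x y (phi k) /\
    forall l : 'I_N, phi k (node_pos x y (node l)) = (k == l)%:R.

Definition area (R : realType) :=
  (@lebesgue_measure R \x @lebesgue_measure R)%E.

(* For f in Q1 the partial derivatives exist off the grid lines, which have
   measure zero; where a derivative fails to exist 'D_v is a default value. *)
Definition grad_dot (R : realType) (f g : R * R -> R) (z : R * R) : R :=
  'D_((1 : R), (0 : R)) f z * 'D_((1 : R), (0 : R)) g z +
  'D_((0 : R), (1 : R)) f z * 'D_((0 : R), (1 : R)) g z.

Definition stiffness (R : realType) (Omega : set (R * R)) (N : nat)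
    (phi : 'I_N -> R * R -> R) : 'M[R]_N :=
  \matrix_(k, l) \int[@area R]_(z in Omega) grad_dot (phi l) (phi k) z.

Definition mass (R : realType) (Omega : set (R * R)) (N : nat)
    (phi : 'I_N -> R * R -> R) : 'M[R]_N :=
  \matrix_(k, l) \int[@area R]_(z in Omega) (phi l z * phi k z).

Definition ker_cV (R : realType) (p q : nat) (B : 'M[R]_(p, q)) :
    set 'cV[R]_q :=
  [set v | B *m v = 0].

Definition inner_solutions (R : realType) (p q : nat) (A M : 'M[R]_(p + q))
    (lambda : R) : set 'cV[R]_p :=
  ker_cV (ulsubmx A - lambda *: ulsubmx M) `&`
  ker_cV (dlsubmx A - lambda *: dlsubmx M).

Definition unique_continuation (R : realType) (p q : nat)
    (A M : 'M[R]_(p + q)) : Prop :=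
  forall lambda : R, inner_solutions A M lambda = [set 0].

(* Main.v *)
(* On an element only the four corner basis functions are nonzero, so the entry
   of A - lambda M at the nodes (i, j) and (i+1, j+1) is an integral over their
   single common element, where the gradients have negative inner product while
   the functions are positive.  For lambda >= 0 this entry is therefore nonzero,
   and the equation at node (i, j) determines u at (i+1, j+1) from nodes that
   precede it; an induction along rows gives u = 0.  For lambda < 0 the energy
   u^T (A - lambda M) u is positive unless u = 0; at the first node (i+1, j+1)
   with a nonzero value, the interpolant of u is a nonzero multiple of a single
   basis function on the element below it, which makes the strict positivity
   visible there.  Hence both cases run through the same induction.  An inner
   solution extended by zero to the boundary nodes vanishes on two edges. *)

Require Import Defs.
From HB Require Import structures.
From mathcomp Require Import all_boot all_order all_algebra.
From mathcomp Require Import all_classical all_reals all_analysis.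
From mathcomp Require Import measurable_realfun ring lra zify.

Import Order.TTheory GRing.Theory Num.Theory.
Import numFieldNormedType.Exports.

Local Open Scope classical_set_scope.
Local Open Scope ring_scope.

Set Implicit Arguments.
Unset Strict Implicit.
Unset Printing Implicit Defensive.

(** * Null sets and strict positivity of integrals *)

Section NullSets.
Context d (T : measurableType d) (R : realType).
Variable mu : {measure set T -> \bar R}.
Import HBNNSimple.
Local Open Scope ereal_scope.

(** A level set of a value [r != 0] loses only points of [N]. The level set of 0 is the only one
    that can grow, and it carries the factor 0. *)
Lemma sintegral_proj_null (N : set T) (mN : measurable N) (h : {nnsfun T >-> R}) :
  mu N = 0 -> sintegral mu (proj_nnsfun h (measurableC mN)) = sintegral mu h.
Proof.
move=> muN0; rewrite /sintegral; apply: eq_fsbigr => r _.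
have [->|r0] := eqVneq r 0%R; first by rewrite !mul0e.
have mh : measurable (h @^-1` [set r]) by [].
congr (_ * _).
have -> : proj_nnsfun h (measurableC mN) @^-1` [set r] = h @^-1` [set r] `\` N.
  rewrite -mrestrict; apply/seteqP; split => t /=; rewrite patchE.
    case: ifPn => [/[!inE]//|_ r0'].
    by case/eqP: r0; rewrite -r0'.
  by move=> [<- Nt]; rewrite (mem_set (_ : (~` N) t)).
have NI : mu (h @^-1` [set r] `&` N) = 0.
  by apply: (@subset_measure0 _ _ _ mu _ N) => //; exact: measurableI.
rewrite -[in RHS](setUIDK (h @^-1` [set r]) N) setUC measureU0//.
- exact: measurableD.
- exact: measurableI.
Qed.

(** Setting a simple function below [f] to 0 on [N] puts it below [g] without changing its
    integral. *)
Lemma le_nnsfun_sup_null (N : set T) (f g : T -> \bar R) :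
  measurable N -> mu N = 0 -> (forall t, 0 <= g t) ->
  (forall t, ~ N t -> f t <= g t) ->
  ereal_sup [set sintegral mu h |
    h in [set h : {nnsfun T >-> R} | forall t, (h t)%:E <= f t]] <=
  ereal_sup [set sintegral mu h |
    h in [set h : {nnsfun T >-> R} | forall t, (h t)%:E <= g t]].
Proof.
move=> mN muN0 g0 fg; apply: ge_ereal_sup => _ [h /= hf <-].
apply: ereal_sup_ubound => /=.
exists (proj_nnsfun h (measurableC mN)); last exact: sintegral_proj_null.
move=> t; rewrite -mrestrict patchE; case: ifPn => [|//].
by rewrite inE => Nt; exact: le_trans (hf t) (fg _ Nt).
Qed.

(* An integral is a difference of suprema over simple functions, so it ignores
   null sets even when the integrand is not known to be measurable. *)
Lemma integral_setD_null (D N : set T) (f : T -> \bar R) :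
  measurable N -> mu N = 0 ->
  \int[mu]_(t in D) f t = \int[mu]_(t in D `\` N) f t.
Proof.
move=> mN muN0; rewrite /integral.
have E t : ~ N t -> (f \_ D) t = (f \_ (D `\` N)) t.
  move=> Nt; rewrite !patchE; congr (if _ then _ else _).
  by apply/idP/idP; rewrite !inE => //; case.
by congr (_ - _); apply/eqP; rewrite eq_le; apply/andP; split;
  apply: le_nnsfun_sup_null mN muN0 _ _ => // t Nt; rewrite ?funeposE ?funenegE E.
Qed.

(** If the integral were 0, the nonnegative [f] would vanish on [G] outside a null set. That null
    set would contain [E], which has positive measure. *)
Lemma Rintegral_gt0 (G E : set T) (f : T -> R) :
  measurable G -> measurable E -> E `<=` G -> 0 < mu E ->
  mu.-integrable G (EFin \o f) ->
  (forall t, G t -> (0 <= f t)%R) -> (forall t, E t -> (0 < f t)%R) ->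
  (0 < \int[mu]_(t in G) f t)%R.
Proof.
move=> mG mE EG muE intf f0 fE; rewrite lt_neqAle Rintegral_ge0// andbT.
apply/eqP => if0; have fin := integrable_fin_num mG intf.
have {}if0 : \int[mu]_(t in G) `|(EFin \o f) t| = 0.
  transitivity (\int[mu]_(t in G) (f t)%:E).
    by apply: eq_integral => t /[!inE] Gt; rewrite gee0_abs ?lee_fin ?f0.
  by move: if0; rewrite /Rintegral => /esym/eqP; rewrite fine_eq0// => /eqP.
have mf := measurable_int mu intf.
have [N [mN muN0 GN]] := (ae_eq_integral_abs mu mG mf).1 if0.
move: muE; rewrite (@subset_measure0 _ _ _ mu E N)// ?ltxx// => t Et.
apply: GN => /= /(_ (EG _ Et))[] ft0.
by have := fE _ Et; rewrite ft0 ltxx.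
Qed.

End NullSets.

(** * Bounded measurable functions *)

Section BoundedMeasurable.
Context d (T : measurableType d) (R : realType).
Implicit Types (D : set T) (f g : T -> R).

(** Unlike integrability, this property is stable under products as well as sums; on sets of finite
    measure it implies integrability. *)
Definition bounded_measurable D f : Prop :=
  measurable_fun D f /\ exists B, forall t, D t -> `|f t| <= B.

Lemma bounded_measurable_cst D r : bounded_measurable D (cst r).
Proof. by split; [exact: measurable_cst|exists `|r|]. Qed.

Lemma bounded_measurableD D f g : bounded_measurable D f ->
  bounded_measurable D g -> bounded_measurable D (fun t => f t + g t).
Proof.
move=> [mf [B fB]] [mg [C gC]]; split; first exact: measurable_funD.
by exists (B + C) => t Dt; rewrite (le_trans (ler_normD _ _))// lerD ?fB ?gC.
Qed.

Lemma bounded_measurableM D f g : bounded_measurable D f ->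
  bounded_measurable D g -> bounded_measurable D (fun t => f t * g t).
Proof.
move=> [mf [B fB]] [mg [C gC]]; split; first exact: measurable_funM.
by exists (B * C) => t Dt; rewrite normrM ler_pM ?fB ?gC.
Qed.

Lemma bounded_measurable_eq D f g : (forall t, D t -> f t = g t) ->
  bounded_measurable D g -> bounded_measurable D f.
Proof.
move=> fg [mg [B gB]]; split; last by exists B => t Dt; rewrite fg ?gB.
by apply: eq_measurable_fun mg => t /[!inE] Dt; rewrite fg.
Qed.

Lemma bounded_measurable_sum D (I : Type) (s : seq I) (F : I -> T -> R) :
  (forall i, bounded_measurable D (F i)) ->
  bounded_measurable D (fun t => \sum_(i <- s) F i t).
Proof.
move=> bF; elim: s => [|i s ih].
  apply: bounded_measurable_eq (bounded_measurable_cst D 0) => t _.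
  by rewrite big_nil.
apply: bounded_measurable_eq (bounded_measurableD (bF i) ih) => t _.
by rewrite big_cons.
Qed.

Lemma bounded_measurable_bigsetU (I : Type) (s : seq I) (F : I -> set T) f :
  (forall i, measurable (F i)) -> (forall i, bounded_measurable (F i) f) ->
  bounded_measurable (\big[setU/set0]_(i <- s) F i) f.
Proof.
move=> mF bF; elim: s => [|i s [ms [B sB]]].
  by rewrite big_nil; split; [exact: measurable_fun_set0|exists 0].
have [mi [C iC]] := bF i.
rewrite big_cons; split; first by apply/measurable_funU => //;
  exact: bigsetU_measurable.
by exists (Num.max B C) => t [/iC|/sB] h; rewrite (le_trans h)// le_max lexx ?orbT.
Qed.

Lemma bounded_measurable_integrable (mu : {measure set T -> \bar R}) D f :
  measurable D -> (mu D < +oo)%E -> bounded_measurable D f ->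
  mu.-integrable D (EFin \o f).
Proof.
move=> mD muD [mf [B fB]]; apply: measurable_bounded_integrable => //.
by exists B; split=> [|C /ltW BC t /= Dt]; rewrite ?num_real// (le_trans (fB _ Dt)).
Qed.

End BoundedMeasurable.

(** * Open mesh cells fill the rectangle up to a null set *)

Section Grid.
Context (R : realType).
Implicit Types x y : nat -> R.

Lemma grid_le (a b : R) n x i j :
  is_grid a b n x -> (i <= j)%N -> (j <= n)%N -> x i <= x j.
Proof.
move=> [_ _ xS]; elim: j => [|j ih]; first by rewrite leqn0 => /eqP->.
rewrite leq_eqVlt => /predU1P[->//|ij] jn.
by rewrite (le_trans (ih ij (ltnW jn)))// ltW// xS.
Qed.

Lemma grid_itv n x t : x 0%N < t -> t < x n ->
  (exists2 i, (i < n)%N & x i < t < x i.+1) \/ (exists2 i, (i <= n)%N & t = x i).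
Proof.
elim: n => [|n ih] x0 tx; first by have := lt_trans x0 tx; rewrite ltxx.
have [tn|nt|->] := ltgtP t (x n); last by right; exists n.
- by case: (ih x0 tn) => -[i ilt ?]; [left|right]; exists i => //;
    [exact: ltnW|exact: leqW].
- by left; exists n => //; rewrite nt.
Qed.

(** Open, in contrast to [mesh_element], so that derivatives at its points see a single bilinear
    formula. *)
Definition cell x y (i j : nat) : set (R * R) :=
  `]x i, x i.+1[%classic `*` `]y j, y j.+1[%classic.

Definition cells n m x y : set (R * R) :=
  \big[setU/set0]_(e : 'I_n * 'I_m) cell x y e.1 e.2.

Lemma cellsP n m x y z : cells n m x y z <->
  exists i j, [/\ (i < n)%N, (j < m)%N & cell x y i j z].
Proof.
rewrite /cells -bigcup_seq; split=> [[[i j] _ /= zij]|[i [j [ilt jlt zij]]]].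
  by exists i, j.
by exists (Ordinal ilt, Ordinal jlt) => //=; exact: mem_index_enum.
Qed.

Lemma cellP x y i j z :
  cell x y i j z <-> (x i < z.1 < x i.+1) /\ (y j < z.2 < y j.+1).
Proof. by rewrite /cell /setX /= !in_itv. Qed.

Lemma measurable_cell x y i j : measurable (cell x y i j).
Proof. by apply: measurableX; exact: measurable_itv. Qed.

Lemma measurable_cells n m x y : measurable (cells n m x y).
Proof. by apply: bigsetU_measurable => e _; exact: measurable_cell. Qed.

Lemma area_oo (a b c d : R) : a < b -> c < d ->
  @area R (open_rect a b c d) = ((b - a) * (d - c))%:E.
Proof.
move=> ab cd; transitivity (@lebesgue_measure R `]a, b[ * @lebesgue_measure R `]c, d[)%E.
  by apply: product_measure1E; exact: measurable_itv.
by rewrite !lebesgue_measure_itv/= !lte_fin ab cd -!EFinB.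
Qed.

Lemma area_cell_gt0 x y i j : x i < x i.+1 -> y j < y j.+1 ->
  (0 < @area R (cell x y i j))%E.
Proof.
by move=> xi yj; rewrite (area_oo xi yj) lte_fin mulr_gt0// subr_gt0.
Qed.

Section Mesh.
Variables (a b c d : R) (n m : nat) (x y : nat -> R).
Hypotheses (hab : a < b) (hcd : c < d).
Hypotheses (hx : is_grid a b n x) (hy : is_grid c d m y).

Lemma cells_sub : cells n m x y `<=` open_rect a b c d.
Proof.
move=> z /cellsP[i [j [ilt jlt /cellP[/andP[xz zx] /andP[yz zy]]]]].
have [x0 xn _] := hx; have [y0 ym _] := hy.
rewrite /open_rect /setX /= !in_itv /= -x0 -xn -y0 -ym; split; apply/andP; split.
- by rewrite (le_lt_trans _ xz)// (grid_le hx)// ltnW.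
- by rewrite (lt_le_trans zx)// (grid_le hx).
- by rewrite (le_lt_trans _ yz)// (grid_le hy)// ltnW.
- by rewrite (lt_le_trans zy)// (grid_le hy).
Qed.

Lemma area_cells_fin : (@area R (cells n m x y) < +oo)%E.
Proof.
apply: (@le_lt_trans _ _ (@area R (open_rect a b c d))).
  apply: le_measure; rewrite ?inE; [exact: measurable_cells| |exact: cells_sub].
  by apply: measurableX; exact: measurable_itv.
by rewrite area_oo// ltry.
Qed.

(** The points left over lie on finitely many vertical and horizontal grid lines, collected in
    [N]. *)
Lemma area_setD_cells : @area R (open_rect a b c d `\` cells n m x y) = 0%E.
Proof.
have cw k (w : nat -> R) : countable (w @` `I_k).
  by apply: finite_set_countable; apply: finite_image; exact: finite_II.
have null k (w : nat -> R) : lebesgue_measure (w @` `I_k) = 0%E.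
  exact/countable_lebesgue_measure0/cw.
have mw k (w : nat -> R) : measurable (w @` `I_k).
  exact/countable_measurable/cw.
have mN1 : measurable (x @` `I_n.+1 `*` [set: R]) by apply: measurableX.
have mN2 : measurable ([set: R] `*` y @` `I_m.+1) by apply: measurableX.
pose N := (x @` `I_n.+1 `*` setT) `|` (setT `*` y @` `I_m.+1) : set (R * R).
apply: (@subset_measure0 _ _ _ (@area R) _ N).
- apply: measurableD; last exact: measurable_cells.
  by apply: measurableX; exact: measurable_itv.
- exact: measurableU.
- move=> [s t] [] ; rewrite /open_rect /setX /= !in_itv/=.
  have [<- <- _] := hx; have [<- <- _] := hy.
  move=> [/andP[x0 xn] /andP[y0 ym]] /cellsP Nst.
  case: (grid_itv x0 xn) => [[i ilt si]|[i ilt si]]; last by left; split => //; exists i.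
  case: (grid_itv y0 ym) => [[j jlt tj]|[j jlt tj]]; last by right; split => //; exists j.
  by case: Nst; exists i, j; split => //; apply/cellP.
- have N1 : @area R (x @` `I_n.+1 `*` setT) = 0%E.
    transitivity (lebesgue_measure (x @` `I_n.+1) * @lebesgue_measure R setT)%E.
      by apply: product_measure1E => //; exact: mw.
    (* The lines have infinite length; the product is 0 by the convention [0 * +oo = 0]. *)
    by rewrite null mul0e.
  have N2 : @area R (setT `*` y @` `I_m.+1) = 0%E.
    transitivity (@lebesgue_measure R setT * lebesgue_measure (y @` `I_m.+1))%E.
      by apply: product_measure1E => //; exact: mw.
    by rewrite null mule0.
  by rewrite -N1; exact: (@measureU0 _ _ _ (@area R) _ _ mN1 mN2 N2).
Qed.

Lemma Rintegral_cells (f : R * R -> R) :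
  \int[@area R]_(z in open_rect a b c d) f z =
  \int[@area R]_(z in cells n m x y) f z.
Proof.
rewrite /Rintegral (integral_setD_null _ _ _ area_setD_cells); last first.
  apply: measurableD; last exact: measurable_cells.
  by apply: measurableX; exact: measurable_itv.
congr (fine (integral _ _ _)).
by rewrite setDD; apply/setIidr/cells_sub.
Qed.

End Mesh.
End Grid.

(** * Bilinear functions on a single element *)

Section LocalShape.
Context (R : realType).
Implicit Types (x y : nat -> R) (f g : R * R -> R).

(** The difference quotient is constant near 0, so its limit is that constant. *)
Lemma derive_near_linear f (z v : R * R) (s : R) :
  (\forall h \near (0 : R), f (h *: v + z) = f z + h * s) -> 'D_v f z = s.
Proof.
move=> fl; apply: norm_lim_near_cst.
near=> h; have h0 : h != 0 by near: h; exact: nbhs_dnbhs_neq.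
rewrite /= (_ : f _ = f z + h * s); last by near: h; exact: nbhs_dnbhs.
by rewrite addrAC subrr add0r; exact: mulKf.
Unshelve. all: by end_near. Qed.

Lemma near_shift_itv (s a b : R) : a < s < b ->
  \forall h \near (0 : R), a < h + s < b.
Proof.
move=> sab.
have : (fun h : R => h + s) @ 0 --> s.
  rewrite -[X in _ --> X](add0r s); apply: (@cvgD _ _ _ _ _ id (cst s)).
    exact: cvg_id.
  exact: cvg_cst.
have /near_in_itvoo nab : s \in `]a, b[ by rewrite in_itv.
move=> cs; have : \forall h \near (0 : R), h + s \in `]a, b[ := cs _ nab.
by apply: filterS => h; rewrite in_itv.
Qed.

Lemma bilinear_on_cell x y i j f : bilinear_on (mesh_element x y i j) f ->
  exists c00 c10 c01 c11 : R,
  [/\ forall z, mesh_element x y i j z ->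
        f z = c00 + c10 * z.1 + c01 * z.2 + c11 * (z.1 * z.2),
      forall z, cell x y i j z -> 'D_((1 : R), (0 : R)) f z = c10 + c11 * z.2 &
      forall z, cell x y i j z -> 'D_((0 : R), (1 : R)) f z = c01 + c11 * z.1].
Proof.
move=> [c00 [c10 [c01 [c11 fE]]]]; exists c00, c10, c01, c11.
have sub z : cell x y i j z -> mesh_element x y i j z.
  by move=> [] /subset_itv_oo_cc ? /subset_itv_oo_cc ?; split.
split=> // -[s t] st; have /cellP[/= hs ht] := st; apply: derive_near_linear.
  near=> h; have /andP[h1 h2] : x i < h + s < x i.+1.
    by near: h; exact: near_shift_itv.
  have -> : h *: ((1 : R), (0 : R)) + (s, t) = (h + s, t).
    by transitivity (h * 1 + s, h * 0 + t) => //; rewrite mulr1 mulr0 add0r.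
  rewrite !fE//=; [by ring|exact: sub|apply: sub; apply/cellP => /=].
  by rewrite h1 h2.
near=> h; have /andP[h1 h2] : y j < h + t < y j.+1.
  by near: h; exact: near_shift_itv.
have -> : h *: ((0 : R), (1 : R)) + (s, t) = (s, h + t).
  by transitivity (h * 0 + s, h * 1 + t) => //; rewrite mulr1 mulr0 add0r.
rewrite !fE//=; [by ring|exact: sub|apply: sub; apply/cellP => /=].
by rewrite h1 h2.
Unshelve. all: by end_near. Qed.

(** Substituting the four coefficients leaves polynomial identities: bilinear interpolation from the
    corners, with denominators cleared by the area [w] of the element. *)
Lemma bilinear_corners x y i j f : x i < x i.+1 -> y j < y j.+1 ->
  bilinear_on (mesh_element x y i j) f -> forall z, cell x y i j z ->
  let w := (x i.+1 - x i) * (y j.+1 - y j) in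
  [/\ w * f z = (x i.+1 - z.1) * (y j.+1 - z.2) * f (x i, y j)
              + (z.1 - x i) * (y j.+1 - z.2) * f (x i.+1, y j)
              + (x i.+1 - z.1) * (z.2 - y j) * f (x i, y j.+1)
              + (z.1 - x i) * (z.2 - y j) * f (x i.+1, y j.+1),
      w * 'D_((1 : R), (0 : R)) f z =
                (y j.+1 - z.2) * (f (x i.+1, y j) - f (x i, y j))
              + (z.2 - y j) * (f (x i.+1, y j.+1) - f (x i, y j.+1)) &
      w * 'D_((0 : R), (1 : R)) f z =
                (x i.+1 - z.1) * (f (x i, y j.+1) - f (x i, y j))
              + (z.1 - x i) * (f (x i.+1, y j.+1) - f (x i.+1, y j))].
Proof.
move=> xi yj /bilinear_on_cell[c00 [c10 [c01 [c11 [fE f1 f2]]]]] z zij w.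
have mem s t : x i <= s <= x i.+1 -> y j <= t <= y j.+1 ->
    mesh_element x y i j (s, t).
  by move=> hs ht; split; rewrite /= in_itv.
have [/andP[/ltW a1 /ltW a2] /andP[/ltW b1 /ltW b2]] := (cellP x y i j z).1 zij.
rewrite (f1 _ zij) (f2 _ zij) (fE z); last first.
  by case: z {zij} a1 a2 b1 b2 => s t /= *; apply: mem; apply/andP.
have [lx ly] := (ltW xi, ltW yj).
rewrite !fE; try (by apply: mem; rewrite lexx ?lx ?ly).
by rewrite /w /=; split; ring.
Qed.

End LocalShape.

(** * Integrals of finite sums *)

Section RintegralSum.
Context d (T : measurableType d) (R : realType).
Variables (mu : {measure set T -> \bar R}) (D : set T).
Hypotheses (mD : measurable D) (muD : (mu D < +oo)%E).

Lemma bounded_measurable_Rintegral_sum (I : Type) (s : seq I) (F : I -> T -> R) :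
  (forall i, bounded_measurable D (F i)) ->
  \int[mu]_(t in D) (\sum_(i <- s) F i t) =
  \sum_(i <- s) \int[mu]_(t in D) F i t.
Proof.
move=> bF; elim: s => [|i s ih].
  rewrite big_nil; under eq_Rintegral do rewrite big_nil.
  by rewrite Rintegral_cst// mul0r.
rewrite big_cons -ih; under eq_Rintegral do rewrite big_cons.
by rewrite RintegralD//; apply: bounded_measurable_integrable => //;
  exact: bounded_measurable_sum.
Qed.

End RintegralSum.

(** * The nodal basis on the mesh *)

Section Stencil.
Context (R : realType) (a b c d : R) (n m : nat) (x y : nat -> R).
Hypotheses (hab : a < b) (hcd : c < d).
Hypotheses (hx : is_grid a b n x) (hy : is_grid c d m y).
Variables (N : nat) (node : 'I_N -> 'I_n.+1 * 'I_m.+1).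
Hypothesis bij_node : bijective node.
Variable phi : 'I_N -> R * R -> R.
Hypothesis hphi : Q1_nodal_basis (open_rect a b c d) x y node phi.

Local Notation Omega := (open_rect a b c d).
Local Notation G := (cells n m x y).
Local Notation mu := (@area R).
Local Notation D1 f := ('D_((1 : R), (0 : R)) f).
Local Notation D2 f := ('D_((0 : R), (1 : R)) f).

Let xS i : (i < n)%N -> x i < x i.+1. Proof. by case: hx => _ _; apply. Qed.
Let yS j : (j < m)%N -> y j < y j.+1. Proof. by case: hy => _ _; apply. Qed.

Let phi_bilinear k i j : (i < n)%N -> (j < m)%N ->
  bilinear_on (mesh_element x y i j) (phi k).
Proof. by move=> ilt jlt; have [[_ +] _] := hphi k; apply. Qed.

(** Grid indices are naturals rather than ordinals, so that neighbours such as [i.+1] can be named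
    without bound proofs. *)
Definition at_node (k : 'I_N) (i j : nat) : bool :=
  (nat_of_ord (node k).1 == i) && (nat_of_ord (node k).2 == j).

Lemma phi_at_node k i j : (i <= n)%N -> (j <= m)%N ->
  phi k (x i, y j) = (at_node k i j)%:R.
Proof.
move=> ilt jlt; have [g gK Kg] := bij_node.
have [_ /(_ (g (inord i, inord j)))] := hphi k.
rewrite Kg /node_pos /= !inordK// => ->; congr (_%:R); congr nat_of_bool.
rewrite -(inj_eq (can_inj gK)) Kg /at_node; case: (node k) => s t.
by rewrite xpair_eqE -!val_eqE /= !inordK.
Qed.

Lemma at_node_inj k i j i' j' : at_node k i j -> at_node k i' j' ->
  i = i' /\ j = j'.
Proof. by move=> /andP[/eqP<- /eqP<-] /andP[/eqP<- /eqP<-]. Qed.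

Lemma at_node_uniq k l i j : at_node k i j -> at_node l i j -> k = l.
Proof.
move=> /andP[/eqP k1 /eqP k2] /andP[/eqP l1 /eqP l2]; apply: (bij_inj bij_node).
by apply/eqP; rewrite -pair_eqE /pair_eq -!val_eqE /= k1 k2 l1 l2 !eqxx.
Qed.

Lemma bounded_measurable_coord i j :
  bounded_measurable (cell x y i j) fst /\ bounded_measurable (cell x y i j) snd.
Proof.
split; split.
- by apply: measurable_funTS; exact: measurable_fst.
- exists (`|x i| + `|x i.+1|) => z /cellP[/andP[h1 h2] _].
  have := ler_norm (x i.+1); have := lerNnormlW (lexx `|x i|).
  have := normr_ge0 (x i); have := normr_ge0 (x i.+1).
  by rewrite ler_norml => *; apply/andP; split; lra.
- by apply: measurable_funTS; exact: measurable_snd.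
- exists (`|y j| + `|y j.+1|) => z /cellP[_ /andP[h1 h2]].
have := ler_norm (y j.+1); have := lerNnormlW (lexx `|y j|).
have := normr_ge0 (y j); have := normr_ge0 (y j.+1).
by rewrite ler_norml => *; apply/andP; split; lra.
Qed.

(** On each cell all three are polynomials in the bounded coordinates; finitely many cells are then
    glued. *)
Lemma bounded_measurable_basis k : [/\ bounded_measurable G (phi k),
  bounded_measurable G (D1 (phi k)) & bounded_measurable G (D2 (phi k))].
Proof.
have H (e : 'I_n * 'I_m) : let E := cell x y e.1 e.2 in
    [/\ bounded_measurable E (phi k), bounded_measurable E (D1 (phi k)) &
        bounded_measurable E (D2 (phi k))].
  have [b1 b2] := bounded_measurable_coord e.1 e.2.
  have [c00 [c10 [c01 [c11 [f0 f1 f2]]]]] :=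
    bilinear_on_cell (phi_bilinear k (ltn_ord e.1) (ltn_ord e.2)).
  have cst r := @bounded_measurable_cst _ _ R (cell x y e.1 e.2) r.
  split; [apply: (bounded_measurable_eq (g := fun z =>
      c00 + c10 * z.1 + c01 * z.2 + c11 * (z.1 * z.2)))|
    apply: (bounded_measurable_eq (g := fun z => c10 + c11 * z.2) f1)|
    apply: (bounded_measurable_eq (g := fun z => c01 + c11 * z.1) f2)];
    try by repeat first [apply: bounded_measurableD|apply: bounded_measurableM|
      exact: cst|exact: b1|exact: b2].
  by move=> z ze; apply: f0; case: ze => /subset_itv_oo_cc ? /subset_itv_oo_cc ?.
by split; apply: bounded_measurable_bigsetU => e;
  first [exact: measurable_cell | case: (H e)].
Qed.

(** * Entries and energy of the pencil [stiffness - lambda *: mass] *)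

Section Form.
Variable lambda : R.

(** The integrand of the entry [(k, l)] of the pencil. *)
Definition form (k l : 'I_N) (z : R * R) : R :=
  grad_dot (phi l) (phi k) z - lambda * (phi l z * phi k z).

Lemma bounded_measurable_form k l : bounded_measurable G (form k l).
Proof.
have [k0 k1 k2] := bounded_measurable_basis k.
have [l0 l1 l2] := bounded_measurable_basis l.
apply: (bounded_measurable_eq (g := fun z => (D1 (phi l) z * D1 (phi k) z +
  D2 (phi l) z * D2 (phi k) z) + (- lambda) * (phi l z * phi k z))).
  by move=> z _; rewrite mulNr.
have cst := @bounded_measurable_cst _ _ R G (- lambda).
by repeat first [apply: bounded_measurableD|apply: bounded_measurableM|
  exact: cst|assumption].
Qed.

Let mG : measurable G. Proof. exact: measurable_cells. Qed.
Let muG : (mu G < +oo)%E. Proof. exact: area_cells_fin hab hcd hx hy. Qed.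

(** Serves both signs of [lambda]: one cell has positive area, so strictness on it is enough. *)
Lemma Rintegral_cells_gt0 (f : R * R -> R) i j : (i < n)%N -> (j < m)%N ->
  bounded_measurable G f -> (forall z, G z -> 0 <= f z) ->
  (forall z, cell x y i j z -> 0 < f z) -> 0 < \int[mu]_(z in G) f z.
Proof.
move=> ilt jlt bf f0 fij.
have EG : cell x y i j `<=` G by move=> z zij; apply/cellsP; exists i, j.
have E0 := area_cell_gt0 (xS ilt) (yS jlt).
have intf := bounded_measurable_integrable (mu := mu) mG muG bf.
exact: (@Rintegral_gt0 _ _ _ mu _ _ f mG (measurable_cell x y i j) EG E0 intf).
Qed.

Lemma pencil_entry k l :
  (stiffness Omega phi - lambda *: mass Omega phi) k l =
  \int[mu]_(z in G) form k l z.
Proof.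
have [k0 k1 k2] := bounded_measurable_basis k.
have [l0 l1 l2] := bounded_measurable_basis l.
rewrite !mxE !(Rintegral_cells hx hy) -RintegralZl//; last first.
  by apply: bounded_measurable_integrable => //; exact: bounded_measurableM.
rewrite -RintegralB//; apply: bounded_measurable_integrable => //.
  apply: (bounded_measurableD (f := fun z => D1 (phi l) z * D1 (phi k) z));
  exact: bounded_measurableM.
apply: (bounded_measurableM (f := fun=> lambda)).
  exact: bounded_measurable_cst.
exact: bounded_measurableM.
Qed.

(** The booleans, coerced to offsets 0 or 1, run through the corners of the cell. A basis function
    that is 0 at all four corners vanishes on the cell together with its derivatives, by
    [bilinear_corners]. *)
Lemma form_eq0 k l i j z : (i < n)%N -> (j < m)%N -> cell x y i j z ->
  (forall e : bool * bool, ~~ at_node k (i + e.1) (j + e.2)) \/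
  (forall e : bool * bool, ~~ at_node l (i + e.1) (j + e.2)) ->
  form k l z = 0.
Proof.
move=> ilt jlt zij.
have zero k' : (forall e : bool * bool, ~~ at_node k' (i + e.1) (j + e.2)) ->
    [/\ phi k' z = 0, D1 (phi k') z = 0 & D2 (phi k') z = 0].
  move=> nk.
  have := bilinear_corners (xS ilt) (yS jlt) (phi_bilinear k' ilt jlt) zij.
  rewrite !phi_at_node//; try exact: ltnW.
  have := nk (false, false); have := nk (false, true).
  have := nk (true, false); have := nk (true, true).
  rewrite /= !addn0 !addn1 => /negbTE-> /negbTE-> /negbTE-> /negbTE->.
  rewrite !mulr0 !subr0 !mulr0 !addr0 => -[h0 h1 h2].
  have w0 : (x i.+1 - x i) * (y j.+1 - y j) != 0.
    by rewrite mulf_neq0// subr_eq0 gt_eqF ?xS ?yS.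
  by split; apply/(mulfI w0); rewrite mulr0.
rewrite /form /grad_dot; case=> /zero[-> -> ->];
  by rewrite ?(mulr0, mul0r) addr0 subrr.
Qed.

(** The form is nonzero on a cell only if both nodes are corners of it, and then their indices
    differ by at most 1 in each direction. *)
Lemma pencil_far k l i j i' j' : at_node k i j -> at_node l i' j' ->
  (i.+1 < i')%N || (j.+1 < j')%N ->
  (stiffness Omega phi - lambda *: mass Omega phi) k l = 0.
Proof.
move=> kij lij far; rewrite pencil_entry.
rewrite (_ : Rintegral _ _ _ = \int[mu]_(z in G) (0 : R)); last first.
  apply: eq_Rintegral => z /[!inE] /cellsP[s [t [slt tlt zst]]].
  apply: form_eq0 slt tlt zst _; apply: contrapT => /not_orP[/existsNP[e1]].
  move=> /negP/negPn k1 /existsNP[e2 /negP/negPn l1].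
  have [ks kt] := at_node_inj kij k1; have [ls lt] := at_node_inj lij l1.
  have [b1 b2] := (leq_b1 e2.1, leq_b1 e2.2).
  by clear - far ks kt ls lt b1 b2; lia.
by rewrite Rintegral_cst// mul0r.
Qed.

(* The two nodes are the opposite corners of one element, so the sign of the
   entry is read off pointwise and no integral has to be evaluated. *)
Lemma pencil_diag k l i j : (i < n)%N -> (j < m)%N -> 0 <= lambda ->
  at_node k i j -> at_node l i.+1 j.+1 ->
  (stiffness Omega phi - lambda *: mass Omega phi) k l < 0.
Proof.
move=> ilt jlt l0 kij lij; rewrite pencil_entry -oppr_gt0 -mulN1r.
have bf := bounded_measurable_form k l.
rewrite -RintegralZl//; last exact: bounded_measurable_integrable.
have neg z : cell x y i j z -> 0 < -1 * form k l z.
  move=> zij.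
  have [wk wk1 wk2] :=
    bilinear_corners (xS ilt) (yS jlt) (phi_bilinear k ilt jlt) zij.
  have [wl wl1 wl2] :=
    bilinear_corners (xS ilt) (yS jlt) (phi_bilinear l ilt jlt) zij.
  have /cellP[/andP[hx0 hx1] /andP[hy0 hy1]] := zij.
  set w := (x i.+1 - x i) * (y j.+1 - y j) in wk wk1 wk2 wl wl1 wl2.
  have w0 : 0 < w by rewrite mulr_gt0// subr_gt0 ?xS ?yS.
  (* Every term is a product of two factors, so scaling by [w * w] gives each of them the [w] that
     the corner formulas require. *)
  rewrite -(pmulr_rgt0 _ (mulr_gt0 w0 w0)); clearbody w; rewrite /form /grad_dot.
  rewrite (_ : w * w * _ = lambda * ((w * phi l z) * (w * phi k z))
    - (w * D1 (phi l) z) * (w * D1 (phi k) z)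
    - (w * D2 (phi l) z) * (w * D2 (phi k) z)); last by ring.
  move: kij lij => /andP[/eqP k1 /eqP k2] /andP[/eqP l1 /eqP l2].
  rewrite wk wk1 wk2 wl wl1 wl2 !phi_at_node//; try exact: ltnW.
  rewrite /at_node k1 k2 l1 l2 !eqxx !(gtn_eqF (ltnSn _)) !(ltn_eqF (ltnSn _)) /=.
  (* In terms of the distances from [z] to the four sides, the goal amounts to [0 < lambda * X0 * X1
     * Y0 * Y1 + Y0 * Y1 + X0 * X1]. *)
  have X0 : 0 < z.1 - x i by rewrite subr_gt0.
  have X1 : 0 < x i.+1 - z.1 by rewrite subr_gt0.
  have Y0 : 0 < z.2 - y j by rewrite subr_gt0.
  have Y1 : 0 < y j.+1 - z.2 by rewrite subr_gt0.
  have XY := mulr_ge0 l0 (ltW (mulr_gt0 (mulr_gt0 X0 X1) (mulr_gt0 Y0 Y1))).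
  by have := mulr_gt0 X0 X1; have := mulr_gt0 Y0 Y1; nra.
apply: (Rintegral_cells_gt0 ilt jlt _ _ neg).
  apply: (bounded_measurableM (f := fun=> -1)) => //.
  exact: bounded_measurable_cst.
move=> z /cellsP[s [t [slt tlt zst]]].
have [/andP[/eqP si /eqP tj]|st] := boolP ((s == i) && (t == j)).
  by subst s t; exact/ltW/neg.
(* No other cell has both nodes among its corners, so the form vanishes there. *)
rewrite (form_eq0 slt tlt zst) ?mulr0//.
apply: contrapT => /not_orP[/existsNP[e1 /negP/negPn k1] /existsNP[e2 /negP/negPn k2]].
have [ks kt] := at_node_inj kij k1; have [ls lt] := at_node_inj lij k2.
have [b1 b2] := (leq_b1 e2.1, leq_b1 e2.2).
by clear - st ks kt ls lt b1 b2; lia.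
Qed.

(** For [f] the identity this is the finite element function with nodal values [u]. For [f] a
    partial derivative it combines the derivatives of the basis functions directly, so linearity of
    differentiation is never invoked. *)
Definition comb (u : 'cV[R]_N) (f : (R * R -> R) -> R * R -> R) (z : R * R) : R :=
  \sum_k u k 0 * f (phi k) z.

Definition energy (u : 'cV[R]_N) (z : R * R) : R :=
  comb u (fun f => D1 f) z ^+ 2 + comb u (fun f => D2 f) z ^+ 2 -
  lambda * comb u id z ^+ 2.

Lemma energyE u z :
  energy u z = \sum_(e : 'I_N * 'I_N) u e.1 0 * u e.2 0 * form e.1 e.2 z.
Proof.
rewrite -(pair_bigA _ (fun k l => u k 0 * u l 0 * form k l z)) /=.
rewrite /energy /comb !expr2 !big_distrlr /= mulr_sumr -big_split -sumrB /=.
apply: eq_bigr => k _; rewrite mulr_sumr -big_split -sumrB /=.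
by apply: eq_bigr => l _; rewrite /form /grad_dot; ring.
Qed.

Lemma bounded_measurable_energy_term (u : 'cV[R]_N) (e : 'I_N * 'I_N) :
  bounded_measurable G (fun z => u e.1 0 * u e.2 0 * form e.1 e.2 z).
Proof.
apply: (bounded_measurableM (f := fun=> u e.1 0 * u e.2 0)).
  exact: bounded_measurable_cst.
exact: bounded_measurable_form.
Qed.

(** Expanding the squares pointwise and exchanging sum and integral gives the quadratic form of the
    pencil. It is 0 at a solution, which is played against [energy_gt0]. *)
Lemma pencil_energy (u : 'cV[R]_N) :
  \sum_k u k 0 * ((stiffness Omega phi - lambda *: mass Omega phi) *m u) k 0 =
  \int[mu]_(z in G) energy u z.
Proof.
under [RHS]eq_Rintegral do rewrite energyE.
rewrite bounded_measurable_Rintegral_sum//; last exact: bounded_measurable_energy_term.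
transitivity (\sum_(e : 'I_N * 'I_N) u e.1 0 * u e.2 0 *
    (stiffness Omega phi - lambda *: mass Omega phi) e.1 e.2).
  rewrite -(pair_bigA _ (fun k l => u k 0 * u l 0 *
    (stiffness Omega phi - lambda *: mass Omega phi) k l)) /=.
  apply: eq_bigr => k _; rewrite mxE mulr_sumr; apply: eq_bigr => l _.
  by rewrite mulrAC mulrA.
apply: eq_bigr => e _; rewrite pencil_entry -RintegralZl//.
by apply: bounded_measurable_integrable => //; exact: bounded_measurable_form.
Qed.

(** All three summands are nonnegative for [lambda < 0]; strictness on cell [(i, j)] comes from the
    mass term alone. *)
Lemma energy_gt0 (u : 'cV[R]_N) l i j : (i < n)%N -> (j < m)%N ->
  lambda < 0 -> at_node l i.+1 j.+1 -> u l 0 != 0 ->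
  (forall k, at_node k i j || at_node k i.+1 j || at_node k i j.+1 ->
    u k 0 = 0) ->
  0 < \int[mu]_(z in G) energy u z.
Proof.
move=> ilt jlt lambda0 lij ul u0; apply: (Rintegral_cells_gt0 ilt jlt).
- apply: bounded_measurable_eq (fun z _ => energyE u z) _.
  exact/bounded_measurable_sum/bounded_measurable_energy_term.
- move=> z _; rewrite /energy addr_ge0//; first by rewrite addr_ge0// sqr_ge0.
  by rewrite -mulNr mulr_ge0 ?sqr_ge0// oppr_ge0 ltW.
move=> z zij; rewrite ltr_wpDl//; first by rewrite addr_ge0// sqr_ge0.
rewrite -mulNr mulr_gt0 ?oppr_gt0// lt_neqAle sqr_ge0 andbT eq_sym sqrf_eq0.
have /cellP[/andP[hx0 hx1] /andP[hy0 hy1]] := zij.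
have S0 : (z.1 - x i) * (z.2 - y j) != 0.
  by rewrite mulf_neq0// subr_eq0 gt_eqF.
suff : (x i.+1 - x i) * (y j.+1 - y j) * comb u id z != 0.
  by apply: contra_neq => ->; rewrite mulr0.
rewrite (_ : _ * comb u id z = (z.1 - x i) * (z.2 - y j) * u l 0).
  exact: mulf_neq0.
rewrite /comb mulr_sumr (bigD1 l)//= big1 ?addr0 => [|k kl].
  have [wl _ _] := bilinear_corners (xS ilt) (yS jlt) (phi_bilinear l ilt jlt) zij.
  rewrite mulrCA wl !phi_at_node//; try exact: ltnW.
  have /andP[/eqP l1 /eqP l2] := lij.
  by rewrite /at_node l1 l2 !eqxx !(gtn_eqF (ltnSn _)) /= !mulr0 !add0r mulr1 mulrC.
(* Any other index has value 0 in [u], or its node is not a corner of this cell. *)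
have [->|uk] := eqVneq (u k 0) 0; first by rewrite mul0r mulr0.
have [wk _ _] := bilinear_corners (xS ilt) (yS jlt) (phi_bilinear k ilt jlt) zij.
rewrite mulrCA wk !phi_at_node//; try exact: ltnW.
have : ~~ (at_node k i j || at_node k i.+1 j || at_node k i j.+1).
  by apply: contra uk => /u0->.
rewrite !negb_or -andbA => /and3P[/negbTE-> /negbTE-> /negbTE->].
rewrite (_ : at_node k i.+1 j.+1 = false) ?mulr0 ?addr0 ?mulr0//.
by apply: contraNF kl => kij; apply/eqP/(at_node_uniq kij lij).
Qed.

(** For [lambda >= 0], take the equation at node [(i, j)]: earlier nodes drop out by hypothesis and
    far ones by [pencil_far], leaving [u l 0] times the nonzero entry of [pencil_diag]. For
    [lambda < 0], the energy of a solution would be both 0 and positive. *)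
Lemma pencil_step (u : 'cV[R]_N) l i j : (i < n)%N -> (j < m)%N ->
  (stiffness Omega phi - lambda *: mass Omega phi) *m u = 0 ->
  (forall k s t, at_node k s t -> (s <= i)%N || ((s == i.+1) && (t <= j)%N) ->
    u k 0 = 0) ->
  at_node l i.+1 j.+1 -> u l 0 = 0.
Proof.
move=> ilt jlt Bu u0 lij; have [lambda0|lambda0] := leP 0 lambda; last first.
  apply/eqP; apply: contraT => ul.
  have : 0 < \int[mu]_(z in G) energy u z.
    apply: energy_gt0 ilt jlt lambda0 lij ul _ => k.
    (* The other three corners of the cell all precede [(i+1, j+1)]. *)
    by case/orP=> [/orP[]|] kij; apply: u0 kij _; rewrite ?leqnn ?eqxx ?orbT.
  rewrite -pencil_energy Bu big1 ?ltxx// => k _; by rewrite mxE mulr0.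
have [g gK Kg] := bij_node.
pose k := g (inord i, inord j).
have kij : at_node k i j.
  by rewrite /at_node /k Kg /= !inordK ?eqxx// ltnW.
have := congr1 (fun v : 'cV[R]_N => v k 0) Bu; rewrite !mxE (bigD1 l)//= big1.
  move/eqP; rewrite addr0 mulf_eq0 => /orP[|/eqP//].
  by rewrite lt_eqF// (pencil_diag ilt jlt lambda0 kij lij).
move=> l' ll'; pose s : nat := (node l').1; pose t : nat := (node l').2.
have l'st : at_node l' s t by rewrite /at_node !eqxx.
have [st|st] := boolP ((s <= i)%N || ((s == i.+1) && (t <= j)%N)).
  by rewrite (u0 _ _ _ l'st st) mulr0.
rewrite (pencil_far kij l'st) ?mul0r//; apply: contraT => far.
(* A node that neither precedes nor is far can only be [(i+1, j+1)], hence [l] itself. *)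
have /andP[/eqP es /eqP et] : (s == i.+1) && (t == j.+1).
  by clearbody s t; clear - st far; lia.
by move: l'st ll'; rewrite es et => l'st; rewrite (at_node_uniq l'st lij) eqxx.
Qed.

Lemma pencil_unique (u : 'cV[R]_N) :
  (stiffness Omega phi - lambda *: mass Omega phi) *m u = 0 ->
  (forall k, (node k).2 = 0%N :> nat \/ (node k).1 = 0%N :> nat -> u k 0 = 0) ->
  u = 0.
Proof.
move=> Bu edge; suff H i j k : at_node k i j -> u k 0 = 0.
  by apply/matrixP => k e; rewrite ord1 mxE; apply: (H (node k).1 (node k).2);
    rewrite /at_node !eqxx.
(* Nested strong induction realizes the lexicographic order on [(i, j)]; an index 0 puts the node on
   one of the two edges. *)
elim/ltn_ind: i j k => i ihi; elim/ltn_ind=> j ihj k kij.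
have /andP[/eqP k1 /eqP k2] := kij.
case: i ihi ihj kij k1 => [|i] ihi ihj kij k1; first by apply: edge; right.
case: j ihj kij k2 => [|j] ihj kij k2; first by apply: edge; left.
have ilt : (i < n)%N by rewrite -ltnS -k1.
have jlt : (j < m)%N by rewrite -ltnS -k2.
apply: (pencil_step ilt jlt Bu _ kij) => k' s t k'st /orP[si|/andP[/eqP si tj]].
  by apply: ihi k'st; rewrite ltnS.
by rewrite si in k'st; apply: ihj k'st; rewrite ltnS.
Qed.

End Form.
End Stencil.

(** * Edges of the rectangle, and the theorem *)

Lemma closure_itvoo (R : realType) (a b s : R) : a < b -> s \in `[a, b] ->
  closure `]a, b[ s.
Proof.
move=> ab sab; have r0 : 0 < (b - a) / 2 by rewrite divr_gt0// subr_gt0.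
(* Midpoint and half-length present the interval as a ball, whose closure is [closed_ball]. *)
have e1 : (a + b) / 2 - (b - a) / 2 = a by field.
have e2 : (a + b) / 2 + (b - a) / 2 = b by field.
have := ball_itv ((a + b) / 2) ((b - a) / 2); rewrite e1 e2 => <-.
have := closed_ball_itv ((a + b) / 2) r0; rewrite e1 e2 /closed_ball => ->.
by [].
Qed.

(** Used to exclude interior nodes from the two edges. Membership in the closure is checked
    coordinatewise; the interior lies in the open rectangle, where both inequalities are strict. *)
Lemma boundary_rect_edge (R : realType) (a b c d s t : R) : a < b -> c < d ->
  a <= s <= b -> c <= t <= d -> s = a \/ t = c ->
  boundary (open_rect a b c d) (s, t).
Proof.
move=> ab cd sab tcd edge; split.
  move=> B [[P Q] /= [Ps Qt] PQB].
  have [s' [s'ab Ps']] := closure_itvoo ab sab Ps.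
  have [t' [t'cd Qt']] := closure_itvoo cd tcd Qt.
  by exists (s', t'); split => //; exact: (PQB (s', t')).
move=> /interior_subset [] /=; rewrite !in_itv/=.
by case: edge => ->; rewrite ltxx.
Qed.

Unset Implicit Arguments.

Theorem theorem3p8 (R : realType) (a b c d : R) (hab : a < b) (hcd : c < d)
    (n m : nat) (x y : nat -> R)
    (hx : is_grid a b n x) (hy : is_grid c d m y)
    (p q : nat) (node : 'I_(p + q) -> 'I_n.+1 * 'I_m.+1)
    (hnode : interior_first (open_rect a b c d) x y node)
    (phi : 'I_(p + q) -> R * R -> R)
    (hphi : Q1_nodal_basis (open_rect a b c d) x y node phi) :
  let A := stiffness (open_rect a b c d) phi in
  let M := mass (open_rect a b c d) phi in
  unique_continuation A M /\
  forall (lambda : R) (u : 'cV[R]_(p + q)),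
    A *m u = lambda *: (M *m u) ->
    (forall k : 'I_(p + q),
       ((node k).2 = 0%N :> nat) \/ ((node k).1 = 0%N :> nat) -> u k 0 = 0) ->
    u = 0.
Proof.
move=> A M; have [bij_node int_node _] := hnode.
have uniq (lambda : R) (u : 'cV[R]_(p + q)) : (A - lambda *: M) *m u = 0 ->
    (forall k, (node k).2 = 0%N :> nat \/ (node k).1 = 0%N :> nat ->
      u k 0 = 0) -> u = 0.
  exact: (pencil_unique hab hcd hx hy bij_node hphi).
split=> [lambda|lambda u Au u0]; last first.
  by apply: (uniq lambda) u0; rewrite mulmxBl -scalemxAl Au subrr.
apply/seteqP; split=> [v [/= vI vB]|_ ->]; last by split; rewrite /ker_cV /= mulmx0.
suff : col_mx v (0 : 'cV_q) = 0.
  by rewrite -[X in _ = X -> _]col_mx0 => /eq_col_mx[].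
apply: (uniq lambda) => [|k edge].
  (* The two kernel conditions are the two block rows of the pencil applied to [col_mx v 0]. *)
  rewrite -[A]submxK -[M]submxK scale_block_mx opp_block_mx add_block_mx.
  by rewrite mul_block_col !mulmx0 !addr0 vI vB col_mx0.
case: (split_ordP k) edge => l -> edge; last by rewrite col_mxEd mxE.
case: (int_node l); rewrite /node_pos.
have [x0 xn _] := hx; have [y0 ym _] := hy.
apply: boundary_rect_edge => //.
- by rewrite -x0 -xn !(grid_le hx)// -ltnS.
- by rewrite -y0 -ym !(grid_le hy)// -ltnS.
- by case: edge => ->; [right|left].
Qed.
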